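(* Both $\mathcal{D}_0$ and $\mathcal{D}\cap[1,2]$ are equal to the set of values $\delta(\psi)$ as $\psi$ ranges over reduced functions (over all alphabets).
   Context: Alphabets are arbitrary sets (finite or infinite) disjoint from $\mathbb{N}^*=\{1,2,\dots\}$; infinite words are right-infinite; the empty word counts as a palindromic prefix. For an infinite word $w$ with infinitely many palindromic prefixes, $(n_i)_{i\ge1}$ is the increasing sequence of their lengths ($n_1=0$) and $\delta(w)=\limsup n_{i+1}/n_i$; otherwise $\delta(w)=\infty$. $w$ has abundant palindromic prefixes if it has infinitely many palindromic prefixes and $n_{i+1}\le 2n_i+1$ for all $i\ge1$. $\mathcal{D}$ is the set of all $\delta(w)$ over infinite words on arbitrary alphabets, $\mathcal{D}_0$ the set of $\delta(w)$ over words with abundant palindromic prefixes. A function is a map $\psi:\mathbb{N}^*\to\mathbb{N}^*\sqcup\mathcal{A}$ with, for every $n\ge1$, $\psi(n)\in\mathcal{A}$ or $1\le\psi(n)\le n-1$. Let $(t_k)_{k\ge0}$ be the (finite or infinite) family, in increasing order, of all $n\ge1$ with $\psi(n)\in\mathcal{A}$ or $1\le\psi(n)\le n-2$. $\psi$ is reduced if for every $k\ge1$ such that $t_k$ exists: $\psi(t_k)\ne\psi(t_{k-1})$, and either $\psi(t_k)\in\mathcal{A}$ or $\psi(t_k)<t_{k-1}$. For reduced $\psi$ define $n_1=0$, $n_{i+1}=2n_i-n_{\psi(i)}$ if $\psi(i)\in\mathbb{N}^*$ and $n_{i+1}=2n_i+1$ if $\psi(i)\in\mathcal{A}$, and $\delta(\psi)=\limsup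 n_{i+1}/n_i$. *)

(* Defs.v *)
From Stdlib Require Import Reals Arith List.
From Coquelicot Require Import Coquelicot.
Import ListNotations.
Open Scope R_scope.

(** Infinite words over an alphabet [A] are maps [nat -> A] (positions 0,1,...). *)

(** [w] has a palindromic prefix of length [n] (the empty prefix, n = 0, counts). *)
Definition pal_prefix {A : Type} (w : nat -> A) (n : nat) : Prop :=
  forall k, (k < n)%nat -> w k = w (n - 1 - k)%nat.

Definition inf_many_pal {A : Type} (w : nat -> A) : Prop :=
  forall N, exists n, (N <= n)%nat /\ pal_prefix w n.

(** [e] is the increasing enumeration of the lengths of palindromic prefixes
    of [w]; 0-based: [e 0] = n_1 = 0, [e i] = n_(i+1). *)
Definition pal_enum {A : Type} (w : nat -> A) (e : nat -> nat) : Prop :=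
  (forall i, (e i < e (S i))%nat) /\
  (forall i, pal_prefix w (e i)) /\
  (forall m, pal_prefix w m -> exists i, e i = m).

Definition ratio_limsup (e : nat -> nat) : Rbar :=
  LimSup_seq (fun i => INR (e (S i)) / INR (e i)).

(** [delta_word w d] : d = delta(w)  (delta(w) = +oo when finitely many
    palindromic prefixes). The enumeration is unique, so this is a function. *)
Definition delta_word {A : Type} (w : nat -> A) (d : Rbar) : Prop :=
  (~ inf_many_pal w /\ d = p_infty) \/
  (inf_many_pal w /\ exists e, pal_enum w e /\ d = ratio_limsup e).

Definition abundant {A : Type} (w : nat -> A) : Prop :=
  inf_many_pal w /\
  exists e, pal_enum w e /\ forall i, (e (S i) <= 2 * e i + 1)%nat.

Definition D_set (d : Rbar) : Prop :=
  exists (A : Type) (w : nat -> A), delta_word w d.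

Definition D0_set (d : Rbar) : Prop :=
  exists (A : Type) (w : nat -> A), abundant w /\ delta_word w d.

(** Functions psi : N* -> N* ⊔ A, encoded as [nat -> nat + A]; only the
    arguments n >= 1 matter.  [inl k] is the integer k, [inr a] the letter a. *)
Definition is_function {A : Type} (psi : nat -> nat + A) : Prop :=
  forall n, (1 <= n)%nat ->
    match psi n with
    | inl k => (1 <= k /\ k <= n - 1)%nat
    | inr _ => True
    end.

Definition in_T {A : Type} (psi : nat -> nat + A) (n : nat) : Prop :=
  (1 <= n)%nat /\
  match psi n with
  | inl k => (1 <= k /\ k <= n - 2)%nat
  | inr _ => True
  end.

(** Reduced: for consecutive elements t_(k-1) = m < n = t_k of the family,
    psi(n) <> psi(m), and psi(n) in A or psi(n) < m. *)
Definition reduced {A : Type} (psi : nat -> nat + A) : Prop :=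
  is_function psi /\
  forall m n, in_T psi m -> in_T psi n -> (m < n)%nat ->
    (forall j, (m < j < n)%nat -> ~ in_T psi j) ->
    psi n <> psi m /\
    match psi n with
    | inl k => (k < m)%nat
    | inr _ => True
    end.

(** The list [n_1; ...; n_i] (1-based indexing of the paper). *)
Fixpoint nlist {A : Type} (psi : nat -> nat + A) (i : nat) : list nat :=
  match i with
  | O => []
  | S j =>
      let l := nlist psi j in
      match j with
      | O => [0%nat]
      | S _ =>
          let nj := nth (j - 1) l 0%nat in
          let next :=
            match psi j with
            | inl k => (2 * nj - nth (k - 1) l 0%nat)%nat  (* 2 n_j - n_(psi j) *)
            | inr _ => (2 * nj + 1)%nat
            end in
          l ++ [next]
      end
  end.

(** n_i for i >= 1 (value at i = 0 is irrelevant). *)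
Definition nseq {A : Type} (psi : nat -> nat + A) (i : nat) : nat :=
  nth (i - 1) (nlist psi i) 0%nat.

(** delta(psi) = limsup_i n_(i+1)/n_i (the term at index 0 is irrelevant). *)
Definition delta_fun {A : Type} (psi : nat -> nat + A) : Rbar :=
  LimSup_seq (fun i => INR (nseq psi (S i)) / INR (nseq psi i)).

Definition Dpsi_set (d : Rbar) : Prop :=
  exists (A : Type) (psi : nat -> nat + A), reduced psi /\ d = delta_fun psi.

(* Main.v *)
Require Import Defs.
From Stdlib Require Import Reals Arith Lia Lra List Classical ClassicalEpsilon.
From Coquelicot Require Import Coquelicot.

(** The three sets are compared cyclically. An abundant word has [1 <= delta <= 2].

    A reduced [psi] yields palindromes [pi_(i+1) = pi_i pi_(psi i)^-1 pi_i] or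
    [pi_i a pi_i], all prefixes of one infinite word; a least palindromic prefix
    missed by the [pi_i] contradicts reducedness by the theorem of Fine and Wilf.

    Conversely let [delta(w) < 2] ([delta = 2] is attained by pairwise distinct
    letters). From some index on, [n_(i+1) = 2 n_i - n_(p i)], and [p i] tends to
    infinity, for otherwise [delta(w) = 2]. Choose [j] with [p i > p j] for all
    [i > j]. Subtracting [n_(p j) + 1] from all [n_i], [i >= j], preserves the
    recursion and the limsup, makes the step at [j] that of a new letter, and all
    earlier lengths that are still needed occur in the initial block [a^M]. *)

(** * Periods of palindromic prefixes and the theorem of Fine and Wilf *)

Definition period {A : Type} (w : nat -> A) (n d : nat) : Prop :=
  forall x, (x + d < n)%nat -> w x = w (x + d)%nat.

Section Periods.
Open Scope nat_scope.
Context {A : Type} (w : nat -> A).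

Lemma pal_prefix_0 : pal_prefix w 0.
Proof. intros k Hk; lia. Qed.

Lemma period_le n m d : m <= n -> period w n d -> period w m d.
Proof. intros Hmn H x Hx; apply H; lia. Qed.

(** The reflections of the two palindromes compose to the translation by [n - o]. *)
Lemma pal_prefix_period n o :
  pal_prefix w n -> pal_prefix w o -> o <= n -> period w n (n - o).
Proof.
  intros Hn Ho Hon x Hx.
  rewrite (Ho x) by lia. rewrite (Hn (o - 1 - x)) by lia. f_equal; lia.
Qed.

Lemma period_pal_prefix n d :
  pal_prefix w n -> period w n d -> d <= n -> pal_prefix w (n - d).
Proof.
  intros Hn Hd Hdn k Hk.
  rewrite (Hd k) by lia. rewrite (Hn (k + d)) by lia. f_equal; lia.
Qed.

(** The period [m - n] of the longer palindrome restricts to the shorter one, which stays a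
    palindrome after the loss of one period. This later supplies the index [p i] with
    [n_(i+1) = 2 n_i - n_(p i)]. *)
Lemma pal_prefix_overlap n m :
  pal_prefix w n -> pal_prefix w m -> n <= m -> m <= 2 * n ->
  pal_prefix w (2 * n - m).
Proof.
  intros Hn Hm H1 H2.
  replace (2 * n - m) with (n - (m - n)) by lia.
  apply period_pal_prefix; [assumption | | lia].
  apply period_le with m; [lia|]. now apply pal_prefix_period.
Qed.

Lemma pal_prefix_extend n d :
  pal_prefix w n -> period w (n + d) d -> d <= n -> pal_prefix w (n + d).
Proof.
  intros Hn Hd Hdn k Hk.
  destruct (Nat.lt_ge_cases k n) as [Hkn|Hkn].
  - rewrite (Hn k Hkn), (Hd (n - 1 - k)) by lia. f_equal; lia.
  - rewrite (Hn (n + d - 1 - k)) by lia.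
    rewrite (Hd (n - 1 - (n + d - 1 - k))) by lia. f_equal; lia.
Qed.

Lemma period_mult n d c x : period w n d -> x + c * d < n -> w x = w (x + c * d).
Proof.
  intros Hd; induction c as [|c IH]; intros Hx.
  - f_equal; lia.
  - rewrite IH by lia. rewrite (Hd (x + c * d)) by lia. f_equal; lia.
Qed.

Lemma period_mod n d x : period w n d -> x < n -> w x = w (x mod d).
Proof.
  intros Hd Hx. pose proof (Nat.div_mod_eq x d) as E.
  rewrite (period_mult n d (x / d) (x mod d) Hd) by lia. f_equal; lia.
Qed.

Lemma period_congr n d x y :
  period w n d -> x < n -> y < n -> x mod d = y mod d -> w x = w y.
Proof.
  intros Hd Hx Hy E.
  now rewrite (period_mod n d x), (period_mod n d y), E.
Qed.

(** Modulo [d] every letter is read in the first block of length [d]. That block lies in the prefix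
    where [f] is a period, and [f] divides [d], so reduction modulo [d] respects residues modulo
    [f]. *)
Lemma period_refine n l d f :
  period w n d -> period w l f -> 0 < d -> d <= l -> Nat.divide f d ->
  period w n f.
Proof.
  intros Hd Hf Hd0 Hdl [c Hc] x Hx. subst d.
  rewrite (period_mod n (c * f) x), (period_mod n (c * f) (x + f)) by (auto; lia).
  assert (f <> 0 /\ c <> 0) as [Hf0 Hc0] by (split; intros ->; lia).
  pose proof (Nat.mod_upper_bound x (c * f)).
  pose proof (Nat.mod_upper_bound (x + f) (c * f)).
  apply (period_congr l f); try assumption; try lia.
  rewrite (Nat.mul_comm c f), !Nat.Div0.mod_mul_r.
  rewrite !(Nat.mul_comm f (_ mod c)), !Nat.Div0.mod_add, !Nat.Div0.mod_mod.
  replace (x + f) with (x + 1 * f) by lia. now rewrite Nat.Div0.mod_add.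
Qed.

(** Subtractive Euclidean algorithm, by induction on [p + q]: for [p < q], the prefix of length
    [n - p] has the periods [p] and [q - p], hence their gcd, which [period_refine] spreads to
    length [n]. *)
Theorem fine_wilf n p q :
  0 < p -> 0 < q -> period w n p -> period w n q -> p + q <= n + Nat.gcd p q ->
  period w n (Nat.gcd p q).
Proof.
  remember (p + q) as s eqn:Es.
  revert n p q Es; induction s as [s IH] using lt_wf_ind.
  assert (main : forall n p q, s = p + q -> 0 < p -> p < q ->
    period w n p -> period w n q -> s <= n + Nat.gcd p q ->
    period w n (Nat.gcd p q)).
  { intros n p q Es Hp Hpq Pp Pq Hn.
    assert (E : Nat.gcd p q = Nat.gcd p (q - p)).
    { replace q with (q - p + p) at 1 by lia. now rewrite Nat.gcd_add_diag_r. }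
    assert (Hg : Nat.gcd p q <= q - p).
    { rewrite E. apply Nat.divide_pos_le; [lia|apply Nat.gcd_divide_r]. }
    apply period_refine with (n - p) p; try assumption; try lia.
    - rewrite E. apply (IH q); try lia.
      + now apply period_le with n; [lia|].
      + intros x Hx. rewrite (Pq x) by lia. rewrite (Pp (x + (q - p))) by lia.
        f_equal; lia.
    - apply Nat.gcd_divide_l. }
  intros n p q Es Hp Hq Pp Pq Hn.
  destruct (Nat.lt_trichotomy p q) as [H|[H|H]].
  - now apply main.
  - subst q. now rewrite Nat.gcd_diag.
  - rewrite Nat.gcd_comm. apply main; try assumption; try lia.
    now rewrite Nat.gcd_comm.
Qed.

(** By Fine and Wilf the gcd is a period, so minimality forces it to equal [d]. The bound [S n]
    suffices because the gcd is at least 1. *)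
Lemma min_period_divides n d p :
  0 < d -> 0 < p -> period w n d -> period w n p -> d + p <= S n ->
  (forall q, 0 < q -> q <= n -> period w n q -> d <= q) -> Nat.divide d p.
Proof.
  intros Hd Hp Pd Pp Hn Hmin.
  assert (Hg : Nat.gcd d p <> 0) by (rewrite Nat.gcd_eq_0; lia).
  assert (Hgd : Nat.gcd d p <= d)
    by (apply Nat.divide_pos_le; [lia|apply Nat.gcd_divide_l]).
  assert (Hle : d <= Nat.gcd d p).
  { apply Hmin; try lia. apply fine_wilf; try assumption; lia. }
  replace d with (Nat.gcd d p) at 1 by lia. apply Nat.gcd_divide_r.
Qed.

(* If consecutive gaps were [d] and then [r * d], the palindrome of length
   [n + d] would have been skipped. *)
Lemma pal_prefix_skipped n d r :
  pal_prefix w n -> pal_prefix w (n + r * d) -> period w n d ->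
  0 < d -> d <= n -> 1 <= r -> r * d <= n -> pal_prefix w (n + d).
Proof.
  intros Hn Hn' Pd Hd Hdn Hr Hrn.
  apply pal_prefix_extend; try assumption.
  intros x Hx. destruct (Nat.lt_ge_cases (x + d) n) as [Hxn|Hxn]; [now apply Pd|].
  pose proof (pal_prefix_period _ _ Hn' Hn ltac:(lia)) as P.
  replace (n + r * d - n) with (r * d) in P by lia.
  assert (d <= r * d) by nia.
  transitivity (w (x + d - r * d)).
  - apply (period_congr n d); try assumption; try lia.
    replace x with (x + d - r * d + (r - 1) * d) at 1 by nia.
    now rewrite Nat.Div0.mod_add.
  - rewrite (P (x + d - r * d)) by lia. f_equal; lia.
Qed.

End Periods.

(** * The lengths [n_i] attached to a function *)

Section LengthSequence.
Open Scope nat_scope.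
Context {A : Type} (psi : nat -> nat + A).
Hypothesis Hpsi : is_function psi.

Lemma nlist_S i : 1 <= i -> nlist psi (S i) =
  nlist psi i ++ (match psi i with
    | inl k => 2 * nth (i - 1) (nlist psi i) 0 - nth (k - 1) (nlist psi i) 0
    | inr _ => 2 * nth (i - 1) (nlist psi i) 0 + 1
    end :: nil).
Proof. destruct i; [lia|reflexivity]. Qed.

Lemma length_nlist i : length (nlist psi i) = i.
Proof.
  induction i as [|i IH]; [reflexivity|].
  destruct i as [|i]; [reflexivity|].
  rewrite nlist_S, length_app, IH by lia; simpl; lia.
Qed.

Lemma nth_nlist i k : 1 <= k <= i -> nth (k - 1) (nlist psi i) 0 = nseq psi k.
Proof.
  induction i as [|i IH]; intros Hk; [lia|].
  destruct (Nat.eq_dec k (S i)) as [->|Hki]; [reflexivity|].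
  rewrite nlist_S, app_nth1 by (rewrite ?length_nlist; lia). apply IH; lia.
Qed.

Lemma nseq_1 : nseq psi 1 = 0.
Proof. reflexivity. Qed.

Lemma nseq_S i : 1 <= i -> nseq psi (S i) =
  match psi i with
  | inl k => 2 * nseq psi i - nseq psi k
  | inr _ => 2 * nseq psi i + 1
  end.
Proof.
  intros Hi. unfold nseq at 1.
  rewrite nlist_S, app_nth2; rewrite ?length_nlist; try lia.
  replace (S i - 1 - i) with 0 by lia; simpl nth.
  pose proof (Hpsi i Hi) as H; destruct (psi i) as [k|a];
    rewrite ?nth_nlist by lia; reflexivity.
Qed.

Lemma nseq_lt_S i : 1 <= i -> nseq psi i < nseq psi (S i).
Proof.
  induction i as [i IH] using lt_wf_ind; intros Hi.
  (* Monotonicity up to [i] gives [n_k < n_i] for [k = psi i], so the truncated subtraction in the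
     recursion is a true one. *)
  assert (mono : forall r k, 1 <= k -> k + r <= i -> nseq psi k + r <= nseq psi (k + r)).
  { induction r as [|r IHr]; intros k Hk Hkr.
    - rewrite !Nat.add_0_r; lia.
    - specialize (IHr k Hk ltac:(lia)). specialize (IH (k + r) ltac:(lia) ltac:(lia)).
      replace (k + S r) with (S (k + r)) by lia. lia. }
  rewrite nseq_S by assumption.
  pose proof (Hpsi i Hi) as H. destruct (psi i) as [k|a]; [|lia].
  specialize (mono (i - k) k ltac:(lia) ltac:(lia)).
  replace (k + (i - k)) with i in mono by lia. lia.
Qed.

Lemma nseq_add i r : 1 <= i -> nseq psi i + r <= nseq psi (i + r).
Proof.
  intros Hi. induction r as [|r IH]; [rewrite !Nat.add_0_r; lia|].
  pose proof (nseq_lt_S (i + r) ltac:(lia)).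
  replace (i + S r) with (S (i + r)) by lia. lia.
Qed.

Lemma nseq_lt i j : 1 <= i -> i < j -> nseq psi i < nseq psi j.
Proof.
  intros Hi Hij. pose proof (nseq_add i (j - i) Hi) as H.
  replace (i + (j - i)) with j in H by lia. lia.
Qed.

Lemma nseq_lt_inv i j : 1 <= i -> 1 <= j -> nseq psi i < nseq psi j -> i < j.
Proof.
  intros Hi Hj H. destruct (Nat.lt_ge_cases i j) as [|Hji]; [assumption|].
  destruct (Nat.eq_dec i j) as [->|]; [lia|].
  pose proof (nseq_lt j i Hj ltac:(lia)). lia.
Qed.

Lemma nseq_ge i : 1 <= i -> i <= S (nseq psi i).
Proof.
  intros Hi. pose proof (nseq_add 1 (i - 1) (le_n 1)) as H.
  replace (1 + (i - 1)) with i in H by lia. lia.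
Qed.

Lemma nseq_bracket m : exists i, 1 <= i /\ nseq psi i <= m < nseq psi (S i).
Proof.
  assert (H : forall j, m < nseq psi (S j) ->
            exists i, 1 <= i /\ nseq psi i <= m < nseq psi (S i)).
  { induction j as [|j IH]; intros Hj; [rewrite nseq_1 in Hj; lia|].
    destruct (Nat.lt_ge_cases m (nseq psi (S j))) as [H|H]; [now apply IH|].
    exists (S j); lia. }
  apply (H (S m)). pose proof (nseq_ge (S (S m)) ltac:(lia)). lia.
Qed.

Lemma nseq_S_le i : 1 <= i -> nseq psi (S i) <= 2 * nseq psi i + 1.
Proof. intros Hi. rewrite nseq_S by assumption. destruct (psi i); lia. Qed.

Lemma not_in_T_pred i : 1 <= i -> ~ in_T psi i -> psi i = inl (i - 1).
Proof.
  intros Hi H. pose proof (Hpsi i Hi) as F. unfold in_T in H.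
  destruct (psi i) as [k|a]; [f_equal; lia | tauto].
Qed.

(** Outside the family [psi j = j - 1], and the recursion says that two consecutive gaps are
    equal. *)
Lemma nseq_arith t i :
  1 <= t -> t < i -> (forall j, t < j < i -> ~ in_T psi j) ->
  forall j, t <= j <= i ->
  nseq psi j = nseq psi t + (j - t) * (nseq psi (S t) - nseq psi t).
Proof.
  intros Ht Hti HT.
  assert (H : forall r, t + r <= i ->
    nseq psi (t + r) = nseq psi t + r * (nseq psi (S t) - nseq psi t)).
  { induction r as [r IH] using lt_wf_ind; intros Hr.
    pose proof (nseq_lt_S t Ht).
    destruct r as [|[|r]].
    - rewrite !Nat.add_0_r; lia.
    - replace (t + 1) with (S t) by lia. lia.
    - replace (t + S (S r)) with (S (t + S r)) by lia.
      rewrite nseq_S by lia.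
      rewrite not_in_T_pred by (try apply HT; lia).
      replace (t + S r - 1) with (t + r) by lia.
      rewrite !IH by lia. lia. }
  intros j Hj. replace j with (t + (j - t)) at 1 by lia. apply H; lia.
Qed.

Lemma in_T_1 : in_T psi 1.
Proof.
  split; [lia|]. pose proof (Hpsi 1 (le_n 1)) as H. destruct (psi 1); [lia|exact I].
Qed.

Lemma previous_in_T i : 1 < i ->
  exists t, 1 <= t /\ t < i /\ in_T psi t /\ forall j, t < j < i -> ~ in_T psi j.
Proof.
  induction i as [|i IH]; intros Hi; [lia|].
  destruct (classic (in_T psi i)) as [Ti|Ti].
  - exists i. split; [lia|]. split; [lia|]. split; [assumption|]. intros j Hj; lia.
  - destruct (Nat.eq_dec i 1) as [->|Hi1]; [elim Ti; apply in_T_1|].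
    destruct IH as (t & Ht & Hti & Tt & HT); [lia|].
    exists t. split; [lia|]. split; [lia|]. split; [assumption|]. intros j Hj.
    destruct (Nat.eq_dec j i) as [->|]; [assumption|]. apply HT; lia.
Qed.

(** * The palindromes [pi_i] and their limit word *)

Fixpoint pal_list (i : nat) : list A :=
  match i with
  | O => nil
  | S j =>
      match j with
      | O => nil
      | S _ =>
          match psi j with
          | inl k => pal_list j ++ skipn (nseq psi k) (pal_list j)
          | inr a => pal_list j ++ a :: pal_list j
          end
      end
  end.

Lemma pal_list_S i : 1 <= i -> pal_list (S i) =
  match psi i with
  | inl k => pal_list i ++ skipn (nseq psi k) (pal_list i)
  | inr a => pal_list i ++ a :: pal_list i
  end.
Proof. destruct i; [lia|reflexivity]. Qed.

Lemma length_pal_list i : 1 <= i -> length (pal_list i) = nseq psi i.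
Proof.
  induction i as [|i IH]; intros Hi; [lia|].
  destruct (Nat.eq_dec i 0) as [->|]; [reflexivity|].
  rewrite pal_list_S, nseq_S by lia.
  pose proof (Hpsi i ltac:(lia)) as F. destruct (psi i) as [k|a].
  - rewrite length_app, length_skipn, IH by lia.
    pose proof (nseq_lt k i ltac:(lia) ltac:(lia)). lia.
  - rewrite length_app; simpl; rewrite IH by lia. lia.
Qed.

Lemma nth_pal_list_le a i j x :
  1 <= i -> i <= j -> x < nseq psi i -> nth x (pal_list j) a = nth x (pal_list i) a.
Proof.
  intros Hi Hij Hx. induction Hij as [|j Hij IH]; [reflexivity|].
  pose proof (nseq_add i (j - i) Hi) as H. replace (i + (j - i)) with j in H by lia.
  rewrite pal_list_S, <- IH by lia.
  destruct (psi j); rewrite app_nth1; rewrite ?length_pal_list; try reflexivity; lia.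
Qed.

(* [w] is the limit of the palindromes [pal_list i]. *)
Definition word_of (w : nat -> A) : Prop :=
  forall i, 1 <= i ->
  match psi i with
  | inl k => forall x, nseq psi i <= x < nseq psi (S i) ->
      w x = w (x - (nseq psi i - nseq psi k))
  | inr a => w (nseq psi i) = a /\
      forall x, nseq psi i < x < nseq psi (S i) -> w x = w (x - (nseq psi i + 1))
  end.

Lemma word_of_exists : exists w, word_of w.
Proof.
  (* The alphabet is inhabited because [psi 1] has to be a letter. *)
  assert (exists a0 : A, True) as [a0 _].
  { pose proof (Hpsi 1 (le_n 1)) as H. destruct (psi 1) as [k|a]; [lia|now exists a]. }
  (* The index [x + 2] is large enough: [n_(x+2) >= x + 1], so the default [a0] is never read. *)
  pose (w := fun x => nth x (pal_list (x + 2)) a0).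
  assert (Hw : forall i x, 1 <= i -> x < nseq psi i -> w x = nth x (pal_list i) a0).
  { intros i x Hi Hx. unfold w. destruct (Nat.le_ge_cases i (x + 2)) as [H|H].
    - now apply nth_pal_list_le.
    - symmetry. apply nth_pal_list_le; try lia.
      pose proof (nseq_ge (x + 2) ltac:(lia)). lia. }
  exists w. intros i Hi.
  pose proof (pal_list_S i Hi) as E. pose proof (nseq_S i Hi) as En.
  pose proof (Hpsi i Hi) as F. destruct (psi i) as [k|a] eqn:Ei.
  - pose proof (nseq_lt k i ltac:(lia) ltac:(lia)). intros x Hx.
    rewrite (Hw (S i) x), (Hw i) by lia.
    rewrite E, app_nth2, nth_skipn by (rewrite length_pal_list; lia).
    rewrite length_pal_list by lia. f_equal; lia.
  - split.
    + rewrite (Hw (S i)) by lia.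
      rewrite E, app_nth2 by (rewrite length_pal_list; lia).
      now rewrite length_pal_list, Nat.sub_diag by lia.
    + intros x Hx. rewrite (Hw (S i) x), (Hw i) by lia.
      rewrite E, app_nth2 by (rewrite length_pal_list; lia).
      rewrite length_pal_list by lia.
      replace (x - nseq psi i) with (S (x - (nseq psi i + 1))) by lia. reflexivity.
Qed.

Lemma word_of_pal w i : word_of w -> 1 <= i -> pal_prefix w (nseq psi i).
Proof.
  intros Hw. induction i as [i IH] using lt_wf_ind; intros Hi.
  destruct (Nat.eq_dec i 1) as [->|Hi1]; [apply pal_prefix_0|].
  destruct i as [|i]; [lia|].
  assert (Hi' : 1 <= i) by lia.
  pose proof (IH i ltac:(lia) Hi') as Pi. pose proof (Hw i Hi') as Wi.
  pose proof (nseq_S i Hi') as En. pose proof (Hpsi i Hi') as F.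
  destruct (psi i) as [k|a].
  - pose proof (nseq_lt k i ltac:(lia) ltac:(lia)) as Hk.
    pose proof (IH k ltac:(lia) ltac:(lia)) as Pk.
    (* The new palindrome continues the period [n_i - n_k] that [pi_i] owes to its palindromic
       prefix [pi_k]. *)
    replace (nseq psi (S i)) with (nseq psi i + (nseq psi i - nseq psi k)) by lia.
    apply pal_prefix_extend; [assumption| |lia].
    intros x Hx. destruct (Nat.lt_ge_cases (x + (nseq psi i - nseq psi k)) (nseq psi i)).
    + now apply (pal_prefix_period w _ _ Pi Pk); [lia|].
    + rewrite (Wi (x + _)) by lia. f_equal; lia.
  - destruct Wi as [Wa Wi]. rewrite En. intros x Hx.
    destruct (Nat.lt_trichotomy x (nseq psi i)) as [H|[H|H]].
    + rewrite (Wi (_ - x)), (Pi x) by lia. f_equal; lia.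
    + f_equal; lia.
    + rewrite (Wi x), (Pi (x - _)) by lia. f_equal; lia.
Qed.

End LengthSequence.

(** * The limit word of a reduced function has no further palindromic prefixes *)

Section Completeness.
Open Scope nat_scope.
Context {A : Type} (psi : nat -> nat + A) (w : nat -> A).
Hypothesis Hred : reduced psi.
Hypothesis Hw : word_of psi w.

Let Hpsi : is_function psi := proj1 Hred.

(* Let [m] be the least missed length, [n_i < m < n_(i+1)]. The gaps
   [m - n_i] and [n_(i+1) - m] are periods of the prefix of length [n_i], so by
   Fine and Wilf both are multiples of its least period [d]. The gaps from the
   last [t < i] in the family on are all equal to [d], so [n_(i+1) - n_i], a
   proper multiple of [d], forces [psi i >= t] or [psi i = psi t], or else it
   makes the prefix of length [n_t] long enough for a period smaller than [d]. *)
Lemma word_of_complete m : pal_prefix w m -> exists i, 1 <= i /\ nseq psi i = m.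
Proof.
  induction m as [m IH] using lt_wf_ind; intros Pm.
  destruct (nseq_bracket psi Hpsi m) as (i & Hi & Him & HmS).
  destruct (Nat.eq_dec (nseq psi i) m) as [E|Hne]; [now exists i|exfalso].
  assert (Hi2 : 1 < i).
  { destruct (Nat.eq_dec i 1) as [->|]; [|lia].
    pose proof (nseq_S_le psi Hpsi 1 (le_n 1)). rewrite nseq_1 in *. lia. }
  pose proof (nseq_S_le psi Hpsi i Hi) as HS.
  (* A period [q] of [pi_j] yields a palindromic prefix shorter than [m], which is some [pi_h] with
     [h < j]. Hence [n_j - n_(j-1)] is the least period of [pi_j]. *)
  assert (Hmin : forall j q, 1 < j -> j <= i -> 0 < q -> q <= nseq psi j ->
            period w (nseq psi j) q -> nseq psi j - nseq psi (j - 1) <= q).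
  { intros j q Hj Hji Hq Hqj Pq.
    assert (nseq psi j <= nseq psi i).
    { destruct (Nat.eq_dec j i) as [->|]; [lia|].
      pose proof (nseq_lt psi Hpsi j i ltac:(lia) ltac:(lia)). lia. }
    destruct (IH (nseq psi j - q)) as (h & Hh & Eh); [lia| |].
    { apply period_pal_prefix; try assumption. apply word_of_pal; auto; lia. }
    assert (Hhj : h < j) by (apply (nseq_lt_inv psi Hpsi); lia).
    destruct (Nat.eq_dec h (j - 1)) as [->|]; [lia|].
    pose proof (nseq_lt psi Hpsi h (j - 1) ltac:(lia) ltac:(lia)). lia. }
  assert (Pper : forall j h, 1 <= h -> h <= j ->
            period w (nseq psi j) (nseq psi j - nseq psi h)).
  { intros j h Hh Hhj. apply pal_prefix_period.
    - apply word_of_pal; auto; lia.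
    - apply word_of_pal; auto.
    - destruct (Nat.eq_dec h j) as [->|]; [lia|].
      pose proof (nseq_lt psi Hpsi h j ltac:(lia) ltac:(lia)). lia. }
  destruct (previous_in_T psi Hpsi i Hi2) as (t & Ht & Hti & Tt & HT).
  pose proof (nseq_arith psi Hpsi t i Ht Hti HT) as Har.
  pose proof (nseq_lt_S psi Hpsi t Ht) as Hdpos.
  remember (nseq psi (S t) - nseq psi t) as d eqn:Ed.
  pose proof (Har i ltac:(lia)) as Ei.
  assert (Ei1 : nseq psi i = nseq psi (i - 1) + d).
  { rewrite (Har (i - 1)), Ei by lia.
    replace (i - t) with (S (i - 1 - t)) by lia. simpl; lia. }
  pose proof (Hmin i) as Hmini. replace (nseq psi i - nseq psi (i - 1)) with d in Hmini by lia.
  specialize (fun q => Hmini q Hi2 (le_n i)).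
  pose proof (Pper i (i - 1) ltac:(lia) ltac:(lia)) as Pd.
  replace (nseq psi i - nseq psi (i - 1)) with d in Pd by lia.
  remember (m - nseq psi i) as d' eqn:Ed'.
  remember (nseq psi (S i) - m) as q eqn:Eq.
  assert (Pd'm : period w m d').
  { subst d'. apply pal_prefix_period; [assumption| |lia]. apply word_of_pal; auto. }
  assert (Pd' : period w (nseq psi i) d') by (apply period_le with m; [lia|assumption]).
  (* The gap [n_(i+1) - n_i = d' + q] is a period of [pi_(i+1)]; the part [d'] is undone inside the
     prefix of length [m]. *)
  assert (Pq : period w (nseq psi i) q).
  { intros x Hx. pose proof (Pper (S i) i Hi ltac:(lia)) as PS.
    rewrite (PS x), (Pd'm (x + q)) by lia. f_equal; lia. }
  assert (d <= q) by (apply Hmini; try assumption; lia).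
  assert (d <= d') by (apply Hmini; try assumption; lia).
  destruct (min_period_divides w (nseq psi i) d d') as [a Ha];
    try assumption; try lia.
  destruct (min_period_divides w (nseq psi i) d q) as [b Hb];
    try assumption; try lia.
  assert (a <> 0 /\ b <> 0) as [Ha0 Hb0] by (split; intros ->; lia).
  assert (ED : nseq psi (S i) = nseq psi i + (a + b) * d) by lia.
  pose proof (nseq_S psi Hpsi i Hi) as EiS.
  pose proof (nseq_S psi Hpsi t Ht) as EtS.
  pose proof (Hpsi i Hi) as Fi. pose proof (Hpsi t Ht) as Ft.
  assert (Ti : in_T psi i).
  { split; [lia|]. destruct (psi i) as [k|c]; [|exact I].
    assert (k < i - 1); [|lia]. apply (nseq_lt_inv psi Hpsi); lia. }
  destruct (proj2 Hred t i Tt Ti Hti HT) as [Hneq Hlt].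
  (* When [psi i] is an integer, [n_(psi i) = n_i - (a + b) d], to be compared with
     [n_t = n_i - (i - t) d]: the value is at least [n_t], or equal to [n_t - d], or smaller. A
     letter acts like an overlap of length -1. *)
  destruct (Nat.le_gt_cases (a + b) (i - t)) as [Hs|Hs];
    [|destruct (Nat.eq_dec (a + b) (S (i - t))) as [Hs1|Hs1]].
  - destruct (psi i) as [k|c]; [|nia].
    pose proof (Har (i - (a + b)) ltac:(lia)) as E.
    pose proof (nseq_lt psi Hpsi k t ltac:(lia) Hlt). nia.
  - rewrite Hs1 in ED. simpl in ED.
    destruct (psi i) as [k|c] eqn:Epi; destruct (psi t) as [k'|c'] eqn:Ept; try lia.
    + pose proof (nseq_lt psi Hpsi k i ltac:(lia) ltac:(lia)).
      pose proof (nseq_lt psi Hpsi k' t ltac:(lia) ltac:(lia)).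
      destruct (Nat.lt_trichotomy k k') as [H'|[H'|H']].
      * pose proof (nseq_lt psi Hpsi k k' ltac:(lia) H'). lia.
      * congruence.
      * pose proof (nseq_lt psi Hpsi k' k ltac:(lia) H'). lia.
    + pose proof (Hw i Hi) as Wi. pose proof (Hw t Ht) as Wt.
      rewrite Epi in Wi. rewrite Ept in Wt.
      destruct Wi as [Wi _], Wt as [Wt _]. apply Hneq. f_equal.
      rewrite <- Wi, <- Wt.
      (* The letter at position [n_i] lies outside [pi_i]; the period [d'] of the prefix of length
         [m] brings it inside, where the period [d] leads to position [n_t]. *)
      transitivity (w (nseq psi i - d')).
      * rewrite (Pd'm (nseq psi i - d')) by lia. f_equal; lia.
      * pose proof (nseq_lt psi Hpsi t i Ht Hti).
        apply (period_congr w (nseq psi i) d); try assumption; try lia.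
        rewrite <- (Nat.Div0.mod_add (nseq psi i - d') a d).
        rewrite <- (Nat.Div0.mod_add (nseq psi t) (i - t) d). f_equal; lia.
  - assert (H2 : 2 * d <= S (nseq psi t)) by nia.
    destruct (psi t) as [k'|c'] eqn:Ept; [|lia].
    assert (Hk' : 1 <= k' /\ k' <= t - 2) by (destruct Tt as [_ Tt]; now rewrite Ept in Tt).
    pose proof (nseq_lt psi Hpsi k' (t - 1) ltac:(lia) ltac:(lia)).
    pose proof (nseq_lt psi Hpsi (t - 1) t ltac:(lia) ltac:(lia)).
    pose proof (Pper t k' ltac:(lia) ltac:(lia)) as Pdt.
    replace (nseq psi t - nseq psi k') with d in Pdt by lia.
    pose proof (Pper t (t - 1) ltac:(lia) ltac:(lia)) as Pft.
    assert (Hdiv : Nat.divide (nseq psi t - nseq psi (t - 1)) d).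
    { apply (min_period_divides w (nseq psi t)); try assumption; try lia.
      intros q' Hq' Hq'' Pq'. apply Hmin; try assumption; lia. }
    assert (d <= nseq psi t - nseq psi (t - 1)); [|lia].
    apply Hmini; try lia.
    apply (period_refine w _ (nseq psi t) d); try assumption; lia.
Qed.

End Completeness.

(** * Upper limits of ratios of consecutive lengths *)

Lemma is_LimSup_seq_LimSup (u : nat -> R) : is_LimSup_seq u (LimSup_seq u).
Proof. unfold LimSup_seq. now destruct (ex_LimSup_seq u). Qed.

Lemma is_LimSup_seq_close (u v : nat -> R) (l : R) :
  is_LimSup_seq u l -> is_lim_seq (fun n => v n - u n) 0 -> is_LimSup_seq v l.
Proof.
  intros Hu Hlim eps.
  assert (He : 0 < eps / 2) by (pose proof (cond_pos eps); lra).
  apply is_lim_seq_spec in Hlim. destruct (Hlim (mkposreal _ He)) as [N HN].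
  destruct (Hu (mkposreal _ He)) as [H1 [N2 H2]].
  simpl in *. split.
  - intros N'. destruct (H1 (Nat.max N N')) as (n & Hn & Hun).
    exists n. split; [lia|]. specialize (HN n ltac:(lia)).
    apply Rabs_def2 in HN. lra.
  - exists (Nat.max N N2). intros n Hn.
    specialize (HN n ltac:(lia)). specialize (H2 n ltac:(lia)).
    apply Rabs_def2 in HN. lra.
Qed.

Section StrictlyIncreasing.
Open Scope nat_scope.
Variable e : nat -> nat.
Hypothesis He : forall i, e i < e (S i).

Lemma incr_add i r : e i + r <= e (i + r).
Proof.
  induction r as [|r IH]; [rewrite !Nat.add_0_r; lia|].
  specialize (He (i + r)). replace (i + S r) with (S (i + r)) by lia. lia.
Qed.

Lemma incr_lt i j : i < j -> e i < e j.
Proof.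
  intros H. pose proof (incr_add i (j - i)).
  replace (i + (j - i)) with j in * by lia. lia.
Qed.

Lemma incr_lt_inv i j : e i < e j -> i < j.
Proof.
  intros H. destruct (Nat.lt_ge_cases i j) as [|Hji]; [assumption|].
  destruct (Nat.eq_dec i j) as [->|]; [lia|]. pose proof (incr_lt j i ltac:(lia)). lia.
Qed.

Lemma incr_ge i : i <= e i.
Proof. pose proof (incr_add 0 i); simpl in *; lia. Qed.

Lemma incr_inj i j : e i = e j -> i = j.
Proof.
  intros H. destruct (Nat.lt_trichotomy i j) as [L|[L|L]]; try assumption;
    apply incr_lt in L; lia.
Qed.

Lemma is_lim_seq_inv_incr C : is_lim_seq (fun i => C / INR (e i))%R 0%R.
Proof.
  apply is_lim_seq_ext with (fun i => C * / INR (e i))%R; [reflexivity|].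
  replace (Finite 0%R) with (Rbar_mult C (Rbar_inv p_infty))
    by (simpl; f_equal; ring).
  apply is_lim_seq_scal_l, is_lim_seq_inv; [|discriminate].
  apply is_lim_seq_le_p_loc with INR; [|apply is_lim_seq_INR].
  exists 0. intros n _. apply le_INR, incr_ge.
Qed.

(** With [a = e i] and [b = e (S i)] the ratios differ by [C (b - a) / (a (a - C))]. This is at most
    [C (1 + C) / a], because [b - a <= a <= (1 + C) (a - C)], and so tends to 0. *)
Lemma ratio_limsup_shift C :
  (forall i, C < e i) -> (forall i, e (S i) <= 2 * e i) -> forall l : R,
  is_LimSup_seq (fun i => INR (e (S i)) / INR (e i))%R l ->
  is_LimSup_seq (fun i => INR (e (S i) - C) / INR (e i - C))%R l.
Proof.
  intros HC H2 l H. apply is_LimSup_seq_close with (1 := H).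
  apply is_lim_seq_le_le with (fun _ => 0%R) (fun i => (INR C * (1 + INR C)) / INR (e i))%R;
    [|apply is_lim_seq_const|apply is_lim_seq_inv_incr].
  intros i. specialize (He i). specialize (HC i). specialize (H2 i).
  rewrite !minus_INR by lia.
  apply lt_INR in He. apply lt_INR in HC as HC'. apply le_INR in H2.
  rewrite mult_INR in H2. simpl (INR 2) in H2.
  assert (HC1 : (1 <= INR (e i) - INR C)%R)
    by (rewrite <- minus_INR by lia; apply (le_INR 1); lia).
  pose proof (pos_INR C).
  set (a := INR (e i)) in *. set (b := INR (e (S i))) in *. set (c := INR C) in *.
  replace ((b - c) / (a - c) - b / a)%R with (c * (b - a) / (a * (a - c)))%R
    by (field; lra).
  assert (0 < a * (a - c))%R by nra. split.
  - apply Rdiv_le_0_compat; [nra|assumption].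
  - apply Rmult_le_reg_r with (a * (a - c))%R; [assumption|].
    replace (c * (b - a) / (a * (a - c)) * (a * (a - c)))%R with (c * (b - a))%R
      by (field; lra).
    replace (c * (1 + c) / a * (a * (a - c)))%R with (c * ((1 + c) * (a - c)))%R
      by (field; lra).
    apply Rmult_le_compat_l; [assumption|]. nra.
Qed.

End StrictlyIncreasing.

Lemma LimSup_ratio_ge_1 (e : nat -> nat) :
  (forall i, (e i < e (S i))%nat) -> Rbar_le 1 (ratio_limsup e).
Proof.
  intros He. rewrite <- (LimSup_seq_const 1). apply LimSup_le.
  (* Index 0 is skipped because [e 0] may vanish. *)
  exists 1%nat. intros n Hn. pose proof (incr_ge e He n).
  apply Rle_div_r; [apply lt_0_INR; lia|].
  rewrite Rmult_1_l. apply le_INR. specialize (He n). lia.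
Qed.

Lemma LimSup_ratio_le_2 (e : nat -> nat) :
  (forall i, (e i < e (S i))%nat) -> (forall i, (e (S i) <= 2 * e i + 1)%nat) ->
  Rbar_le (ratio_limsup e) 2.
Proof.
  intros He H2.
  assert (L : is_lim_seq (fun i => 2 + 1 / INR (e i)) 2).
  { replace (Finite 2) with (Finite (2 + 0)) by (f_equal; ring).
    apply is_lim_seq_plus'; [apply is_lim_seq_const|now apply is_lim_seq_inv_incr]. }
  rewrite <- (is_LimSup_seq_unique _ _ (is_lim_LimSup_seq _ _ L)). apply LimSup_le.
  exists 1%nat. intros n Hn. pose proof (incr_ge e He n).
  assert (0 < INR (e n)) by (apply lt_0_INR; lia).
  apply Rle_div_l; [assumption|].
  replace ((2 + 1 / INR (e n)) * INR (e n)) with (2 * INR (e n) + 1) by (field; lra).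
  specialize (H2 n). apply le_INR in H2.
  rewrite plus_INR, mult_INR in H2. exact H2.
Qed.

(** * From reduced functions to abundant words *)

(** Needed because [abundant] and [delta_word] each choose their own enumeration. *)
Lemma pal_enum_unique {A : Type} (w : nat -> A) (e f : nat -> nat) :
  pal_enum w e -> pal_enum w f -> forall i, e i = f i.
Proof.
  intros (He & Pe & Se) (Hf & Pf & Sf).
  assert (main : forall e f : nat -> nat, (forall i, (e i < e (S i))%nat) ->
    (forall i, (f i < f (S i))%nat) -> (forall i, exists j, e j = f i) ->
    forall i, (forall k, (k < i)%nat -> e k = f k) -> (e i <= f i)%nat).
  { clear. intros e f He Hf S i IH. destruct (S i) as [j Hj]. rewrite <- Hj.
    destruct (Nat.lt_ge_cases j i) as [H|H].
    - rewrite IH in Hj by assumption. apply incr_inj in Hj; [lia|assumption].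
    - destruct (Nat.eq_dec i j) as [->|]; [lia|].
      apply Nat.lt_le_incl, incr_lt; [assumption|lia]. }
  intros i. induction i as [i IH] using lt_wf_ind.
  apply Nat.le_antisymm; apply main; auto. intros k Hk. now symmetry; apply IH.
Qed.

Lemma abundant_delta_range (d : Rbar) :
  D0_set d -> D_set d /\ Rbar_le 1 d /\ Rbar_le d 2.
Proof.
  intros (A & w & [Hinf (e & Ee & He)] & Hd). split; [now exists A, w|].
  destruct Hd as [[H _]|(_ & f & Ef & ->)]; [contradiction|].
  pose proof (pal_enum_unique w e f Ee Ef) as E.
  assert (Hf : forall i, (f (S i) <= 2 * f i + 1)%nat)
    by (intros i; rewrite <- !E; apply He).
  split; [apply LimSup_ratio_ge_1|apply LimSup_ratio_le_2]; try assumption; apply Ef.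
Qed.

Lemma reduced_delta_abundant (d : Rbar) : Dpsi_set d -> D0_set d.
Proof.
  intros (A & psi & Hred & ->). pose proof (proj1 Hred) as Hpsi.
  destruct (word_of_exists psi Hpsi) as [w Hw]. exists A, w.
  assert (Ee : pal_enum w (fun i => nseq psi (S i))).
  { split; [|split].
    - intros i. apply nseq_lt_S; [assumption|lia].
    - intros i. apply word_of_pal; auto; lia.
    - intros m Pm. destruct (word_of_complete psi w Hred Hw m Pm) as (i & Hi & E).
      exists (i - 1)%nat. replace (S (i - 1)) with i by lia. exact E. }
  assert (Hinf : inf_many_pal w).
  { intros N. exists (nseq psi (S N)). split.
    - pose proof (nseq_ge psi Hpsi (S N) ltac:(lia)). lia.
    - apply Ee. }
  split.
  - split; [assumption|]. eexists; split; [exact Ee|].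
    intros i. apply nseq_S_le; [assumption|lia].
  - right. split; [assumption|]. eexists; split; [exact Ee|].
    apply is_LimSup_seq_unique.
    (* The enumeration of [w] is 0-based and the [n_i] are 1-based, so the two ratio sequences
       differ by a shift of one. *)
    apply (is_LimSup_seq_ind_1 (fun i => INR (nseq psi (S i)) / INR (nseq psi i))).
    apply is_LimSup_seq_LimSup.
Qed.

Lemma Dpsi_set_2 : Dpsi_set 2.
Proof.
  exists nat, (fun n : nat => inr n : nat + nat).
  assert (Hred : reduced (fun n : nat => inr n : nat + nat)).
  { split.
    - intros n Hn; exact I.
    - intros m n Tm Tn Hmn _. split; [|exact I]. intros E; injection E; lia. }
  split; [assumption|].
  apply Rbar_le_antisym.
  - rewrite <- (LimSup_seq_const 2). apply LimSup_le. exists 2%nat. intros n Hn.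
    pose proof (nseq_ge _ (proj1 Hred) n ltac:(lia)).
    apply Rle_div_r; [apply lt_0_INR; lia|].
    rewrite (nseq_S _ (proj1 Hred)) by lia.
    rewrite plus_INR, mult_INR. simpl (INR 2). simpl (INR 1). lra.
  (* The upper bound comes for free from the abundant word attached to this function. *)
  - assert (H : Dpsi_set (delta_fun (fun n : nat => inr n : nat + nat))).
    { eexists _, _. split; [exact Hred|reflexivity]. }
    now apply reduced_delta_abundant, abundant_delta_range in H.
Qed.

(** * Choice of the index at which a word is cut *)

(** Take for [j] the last index from [i0] on with [f j <= f i0]; the induction descends from [J] in
    search of it. *)
Lemma eventually_last_min (f : nat -> nat) (i0 : nat) :
  (forall c, exists J, forall i, (J <= i)%nat -> (c < f i)%nat) ->
  exists j, (i0 <= j)%nat /\ forall i, (j < i)%nat -> (f j < f i)%nat.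
Proof.
  intros Hf. destruct (Hf (f i0)) as [J HJ].
  assert (H : forall r, (forall i, (i0 + r <= i)%nat -> (f i0 < f i)%nat) ->
    exists j, (i0 <= j)%nat /\ forall i, (j < i)%nat -> (f j < f i)%nat).
  { induction r as [|r IH]; intros Hr.
    - exists i0. split; [lia|]. intros i Hi. apply Hr; lia.
    - destruct (Nat.lt_ge_cases (f i0) (f (i0 + r)%nat)) as [L|L].
      + apply IH. intros i Hi. destruct (Nat.eq_dec i (i0 + r)) as [->|]; [assumption|].
        apply Hr; lia.
      + exists (i0 + r)%nat. split; [lia|]. intros i Hi. specialize (Hr i). lia. }
  apply (H J). intros i Hi. apply HJ; lia.
Qed.

(** Eventually the ratio stays below [2 - (2 - l) / 2], so the overlap [2 e_i - e_(i+1)] exceeds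
    [e_i (2 - l) / 2], which is unbounded. *)
Lemma LimSup_ratio_lt_2 (e : nat -> nat) (l : R) :
  (forall i, (e i < e (S i))%nat) ->
  is_LimSup_seq (fun i => INR (e (S i)) / INR (e i)) l -> l < 2 ->
  forall c, exists J, forall i, (J <= i)%nat -> (e (S i) + c < 2 * e i)%nat.
Proof.
  intros He H Hl c.
  assert (Hp : 0 < (2 - l) / 2) by lra.
  destruct (H (mkposreal _ Hp)) as [_ [N HN]]. simpl in HN.
  destruct (INR_unbounded (INR c / ((2 - l) / 2))) as [N2 HN2].
  exists (Nat.max 1 (Nat.max N N2)). intros i Hi. specialize (HN i ltac:(lia)).
  pose proof (incr_ge e He i) as Hei.
  assert (He0 : 0 < INR (e i)) by (apply lt_0_INR; lia).
  assert (HN3 : INR N2 <= INR (e i)) by (apply le_INR; lia).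
  apply Rlt_div_l in HN; [|assumption].
  assert (Hc : INR c < INR (e i) * ((2 - l) / 2)) by (apply Rlt_div_l; lra).
  apply INR_lt. rewrite plus_INR, mult_INR. simpl (INR 2). lra.
Qed.

(** * From a word with delta below 2 to a reduced function *)

Section Reduction.
Open Scope nat_scope.
Context {A : Type} (w : nat -> A) (e p : nat -> nat) (i0 : nat).
Hypothesis Ee : pal_enum w e.
Hypothesis Hp : forall i, i0 <= i -> e (S i) + e (p i) = 2 * e i.

Let He : forall i, e i < e (S i) := proj1 Ee.

Lemma overlap_index_lt i : i0 <= i -> p i < i.
Proof.
  intros Hi. apply (incr_lt_inv e He).
  specialize (Hp i Hi). specialize (He i). lia.
Qed.

(** All gaps from [m] to [i] equal [d]. If [p i >= m] the next gap is [(i - p i) d], and if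
    [p i = p m] it is [(i - m + 1) d]. Either is a multiple of [d] by at least 2, so the palindromic
    prefix of length [e i + d] would be missing from the enumeration. *)
Lemma overlap_index_reduced m i :
  i0 <= m -> m < i -> (forall l, m < l < i -> p l = l - 1) -> p i <> i - 1 ->
  p i < m /\ p i <> p m.
Proof.
  intros Hm Hmi HT Hpi. pose proof (He m) as Hdpos.
  remember (e (S m) - e m) as d eqn:Ed.
  assert (Har : forall r, m + r <= i -> e (m + r) = e m + r * d).
  { induction r as [r IH] using lt_wf_ind; intros Hr. destruct r as [|[|r]].
    - rewrite Nat.add_0_r; lia.
    - replace (m + 1) with (S m) by lia. lia.
    - pose proof (Hp (m + S r) ltac:(lia)) as E. rewrite HT in E by lia.
      replace (m + S r - 1) with (m + r) in E by lia.
      replace (m + S (S r)) with (S (m + S r)) by lia.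
      rewrite !IH in E by lia. lia. }
  assert (Ei : e i = e m + (i - m) * d)
    by (rewrite <- Har by lia; f_equal; lia).
  assert (Ei1 : e i - e (i - 1) = d).
  { replace (i - 1) with (m + (i - 1 - m)) by lia. rewrite Har, Ei by lia.
    replace (i - m) with (S (i - 1 - m)) by lia. simpl; lia. }
  assert (key : forall r, 2 <= r -> e (S i) <> e i + r * d).
  { intros r Hr E. pose proof (Hp i ltac:(lia)).
    assert (Pn : pal_prefix w (e i + d)).
    { apply (pal_prefix_skipped w (e i) d r); try lia.
      - apply Ee.
      - rewrite <- E. apply Ee.
      - rewrite <- Ei1. apply pal_prefix_period; try apply Ee. lia. }
    destruct (proj2 (proj2 Ee) _ Pn) as [k Hk].
    assert (i < k) by (apply (incr_lt_inv e He); lia).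
    assert (k < S i) by (apply (incr_lt_inv e He); nia). lia. }
  pose proof (overlap_index_lt i ltac:(lia)) as Hlt.
  pose proof (Hp i ltac:(lia)) as Ep. pose proof (Hp m Hm) as Em.
  split.
  - destruct (Nat.lt_ge_cases (p i) m) as [|Hge]; [assumption|exfalso].
    pose proof (Har (p i - m) ltac:(lia)) as E.
    replace (m + (p i - m)) with (p i) in E by lia.
    apply (key (i - p i)); [lia|]. nia.
  - intros E. rewrite E in Ep. apply (key (S (i - m))); [lia|]. simpl; lia.
Qed.

Variable j : nat.
Hypothesis Hj : i0 <= j.
Hypothesis Hmin : forall i, j < i -> p j < p i.

Let M := e j - e (p j) - 1.

(* The palindromes [pi_i], [i >= j], are shortened by [e (p j) + 1] letters,
   which turns [pi_j] into [a^M] and the overlap [pi_(p j)] of its two copies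
   in [pi_(j+1)] into a gap of length one, filled by a new letter. Lengths
   [0, ..., M] are all available in [a^M], so later overlaps can be kept. *)
Definition shortened (x : nat) : nat + bool :=
  if x <=? M then (if x =? 1 then inr true else inl (x - 1))
  else if x =? S M then inr false
  else let k := p (j + (x - S M)) in
       if j <=? k then inl (S M + (k - j)) else inl (e k - e (p j)).

Lemma shortened_low x : 1 <= x <= M ->
  shortened x = if x =? 1 then inr true else inl (x - 1).
Proof. intros H. unfold shortened. now rewrite (proj2 (Nat.leb_le _ _)) by lia. Qed.

Lemma shortened_mid : shortened (S M) = inr false.
Proof.
  unfold shortened. rewrite (proj2 (Nat.leb_gt _ _)) by lia.
  now rewrite Nat.eqb_refl.
Qed.

Lemma shortened_high r : 1 <= r -> shortened (S M + r) =
  if j <=? p (j + r) then inl (S M + (p (j + r) - j)) else inl (e (p (j + r)) - e (p j)).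
Proof.
  intros H. unfold shortened. rewrite (proj2 (Nat.leb_gt _ _)) by lia.
  rewrite (proj2 (Nat.eqb_neq _ _)) by lia.
  now replace (S M + r - S M) with r by lia.
Qed.

Lemma shortened_M : e j = M + e (p j) + 1.
Proof.
  unfold M. pose proof (incr_lt e He _ _ (overlap_index_lt j Hj)). lia.
Qed.

(** For an old index [k] between [p j] and [j], the shortened length is [e k - e (p j) - 1]. In the
    initial block the length [x - 1] has index [x], so the new index is [e k - e (p j)]. *)
Lemma low_value k : p j < k -> k < j -> 1 <= e k - e (p j) <= M.
Proof.
  intros H1 H2. pose proof (incr_lt e He _ _ H1). pose proof (incr_lt e He _ _ H2).
  unfold M. lia.
Qed.

Lemma shortened_is_function : is_function shortened.
Proof.
  intros x Hx. destruct (Nat.lt_trichotomy x (S M)) as [H|[->|H]].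
  - rewrite shortened_low by lia. destruct (Nat.eqb_spec x 1); [exact I|lia].
  - now rewrite shortened_mid.
  - remember (x - S M) as r eqn:Er. replace x with (S M + r) in * by lia.
    clear Er. rewrite shortened_high by lia.
    pose proof (overlap_index_lt (j + r) ltac:(lia)).
    pose proof (low_value (p (j + r)) (Hmin (j + r) ltac:(lia))) as L.
    destruct (Nat.leb_spec j (p (j + r))); cbv iota; lia.
Qed.

(** Values taken in the initial block are at most [M <= S M + r - 2], so they always put the index
    in the family; the other values are translated. *)
Lemma shortened_in_T r : 1 <= r ->
  (in_T shortened (S M + r) <-> p (j + r) <> j + r - 1).
Proof.
  intros Hr. unfold in_T. rewrite shortened_high by assumption.
  pose proof (overlap_index_lt (j + r) ltac:(lia)).
  destruct (Nat.leb_spec j (p (j + r))); cbv iota; [lia|].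
  pose proof (low_value (p (j + r)) (Hmin (j + r) ltac:(lia)) ltac:(lia)). lia.
Qed.

Lemma shortened_in_T_low x : x <= M -> in_T shortened x -> x = 1.
Proof.
  intros Hx [Hx1 H]. rewrite shortened_low in H by lia.
  destruct (Nat.eqb_spec x 1); [assumption|lia].
Qed.

Lemma shortened_reduced : reduced shortened.
Proof.
  split; [apply shortened_is_function|].
  intros x y Tx Ty Hxy HT. pose proof (proj1 Tx) as Hx.
  destruct (Nat.lt_trichotomy y (S M)) as [H|[->|H]].
  - apply shortened_in_T_low in Ty; lia.
  - assert (x = 1) by (apply shortened_in_T_low; [lia|assumption]). subst x.
    rewrite shortened_mid, shortened_low by lia. split; [discriminate|exact I].
  (* Since [S M] itself is in the family, the predecessor of [y] is not in the initial block, and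
     [overlap_index_reduced] applies to the original indices. *)
  - assert (HxM : S M <= x).
    { destruct (Nat.le_gt_cases (S M) x) as [|Hlt]; [assumption|].
      elim (HT (S M)); [lia|]. split; [lia|]. now rewrite shortened_mid. }
    remember (x - S M) as r' eqn:Er'. remember (y - S M) as r eqn:Er.
    replace x with (S M + r') in * by lia. replace y with (S M + r) in * by lia.
    clear Er Er'. apply shortened_in_T in Ty; [|lia].
    destruct (overlap_index_reduced (j + r') (j + r)) as [R1 R2]; try assumption; try lia.
    { intros l Hl. apply NNPP. intros Hne. apply (HT (S M + (l - j))); [lia|].
      apply shortened_in_T; [lia|]. now replace (j + (l - j)) with l by lia. }
    rewrite shortened_high by lia.
    pose proof (low_value (p (j + r)) (Hmin (j + r) ltac:(lia))) as L.
    split.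
    + destruct (Nat.eq_dec r' 0) as [->|Hr'].
      * rewrite Nat.add_0_r, shortened_mid.
        destruct (j <=? p (j + r)); discriminate.
      * rewrite shortened_high by lia.
        pose proof (low_value (p (j + r')) (Hmin (j + r') ltac:(lia))) as L'.
        destruct (Nat.leb_spec j (p (j + r))), (Nat.leb_spec j (p (j + r')));
          intros E; injection E; intros E'; try lia.
        apply R2, (incr_inj e He). lia.
    + destruct (Nat.leb_spec j (p (j + r))); cbv iota; lia.
Qed.

Lemma nseq_shortened_low x : 1 <= x <= S M -> nseq shortened x = x - 1.
Proof.
  induction x as [x IH] using lt_wf_ind; intros Hx.
  destruct (Nat.eq_dec x 1) as [->|]; [reflexivity|].
  destruct x as [|x]; [lia|].
  rewrite (nseq_S _ shortened_is_function), shortened_low by lia.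
  destruct (Nat.eqb_spec x 1) as [->|]; [rewrite IH; lia|rewrite !IH; lia].
Qed.

(** The coefficients of [2 x - y] sum to 1, so the recursion commutes with subtracting the constant
    [e (p j) + 1]. At [j] the overlap becomes -1, which is the step [2 M + 1] of a letter. *)
Lemma nseq_shortened r : nseq shortened (S M + r) = e (j + r) - (e (p j) + 1).
Proof.
  pose proof shortened_M as EM. pose proof (Hp j Hj) as Ej.
  induction r as [r IH] using lt_wf_ind. destruct r as [|r].
  - rewrite !Nat.add_0_r, nseq_shortened_low by lia. lia.
  - pose proof (IH r ltac:(lia)) as IHr.
    replace (S M + S r) with (S (S M + r)) by lia.
    rewrite (nseq_S _ shortened_is_function) by lia.
    destruct (Nat.eq_dec r 0) as [->|Hr].
    + rewrite Nat.add_0_r, shortened_mid, nseq_shortened_low by lia.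
      replace (j + 1) with (S j) by lia. lia.
    + rewrite shortened_high by lia. rewrite IHr.
      pose proof (Hp (j + r) ltac:(lia)) as Er.
      replace (j + S r) with (S (j + r)) by lia.
      pose proof (overlap_index_lt (j + r) ltac:(lia)).
      pose proof (incr_add e He j r).
      pose proof (low_value (p (j + r)) (Hmin (j + r) ltac:(lia))) as L.
      destruct (Nat.leb_spec j (p (j + r))) as [Hk|Hk].
      * rewrite IH by lia. replace (j + (p (j + r) - j)) with (p (j + r)) by lia.
        pose proof (incr_add e He j (p (j + r) - j)) as Hjk.
        replace (j + (p (j + r) - j)) with (p (j + r)) in Hjk by lia. lia.
      * rewrite nseq_shortened_low by lia. lia.
Qed.

Lemma delta_shortened (l : R) :
  is_LimSup_seq (fun i => INR (e (S i)) / INR (e i))%R l ->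
  delta_fun shortened = l.
Proof.
  intros H. apply is_LimSup_seq_unique.
  (* Both sequences start one step after the cut: [M] may be 0, and [ratio_limsup_shift] wants
     positive shortened lengths. *)
  apply (is_LimSup_seq_ind_k _ (S M + 1)).
  apply (is_LimSup_seq_ind_k _ (j + 1)) in H.
  eapply is_LimSup_seq_ext;
    [|apply (ratio_limsup_shift (fun i => e (i + (j + 1))) ) with (C := e (p j) + 1);
      [| | |exact H]].
  - intros n; cbv beta.
    replace (S (n + (S M + 1))) with (S M + (S (S n))) by lia.
    replace (n + (S M + 1)) with (S M + S n) by lia.
    rewrite !nseq_shortened.
    replace (S n + (j + 1)) with (j + S (S n)) by lia.
    now replace (n + (j + 1)) with (j + S n) by lia.
  - intros i. apply He.
  - intros i. pose proof shortened_M. pose proof (incr_add e He j (i + 1)).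
    replace (i + (j + 1)) with (j + (i + 1)) by lia. lia.
  - intros i. pose proof (Hp (i + (j + 1)) ltac:(lia)). simpl. simpl in H0. lia.
Qed.

End Reduction.

(** * Closing the cycle of inclusions *)

Lemma delta_lt_2_reduced {A : Type} (w : nat -> A) (e : nat -> nat) (l : R) :
  pal_enum w e -> is_LimSup_seq (fun i => INR (e (S i)) / INR (e i)) l -> l < 2 ->
  Dpsi_set l.
Proof.
  intros Ee Hl Hl2. pose proof (proj1 Ee) as He.
  pose proof (LimSup_ratio_lt_2 e l He Hl Hl2) as Hgap.
  destruct (Hgap 0%nat) as [i0 Hi0].
  (* The bound on [i] is placed under the existential so that the choice function [p] is total. *)
  assert (Hex : forall i, exists k, (i0 <= i -> e (S i) + e k = 2 * e i)%nat).
  { intros i. destruct (Nat.le_gt_cases i0 i) as [Hi|Hi]; [|exists 0%nat; lia].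
    specialize (Hi0 i Hi). specialize (He i).
    destruct (proj2 (proj2 Ee) (2 * e i - e (S i))%nat) as [k Hk].
    - apply pal_prefix_overlap; try apply Ee; lia.
    - exists k. lia. }
  pose (p := fun i => proj1_sig (constructive_indefinite_description _ (Hex i))).
  assert (Hp : forall i, (i0 <= i -> e (S i) + e (p i) = 2 * e i)%nat)
    by (intros i; exact (proj2_sig (constructive_indefinite_description _ (Hex i)))).
  destruct (eventually_last_min p i0) as (j & Hj & Hmin).
  (* The overlap [e (p i)] eventually exceeds [e c], hence [p i > c]. *)
  { intros c. destruct (Hgap (e c)) as [J HJ]. exists (Nat.max i0 J). intros i Hi.
    apply (incr_lt_inv e He). specialize (Hp i ltac:(lia)).
    specialize (HJ i ltac:(lia)). lia. }
  exists bool, (shortened e p j). split.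
  - now apply (shortened_reduced w e p i0).
  - symmetry. now apply (delta_shortened w e p i0).
Qed.

Lemma delta_range_reduced (d : Rbar) :
  D_set d -> Rbar_le 1 d -> Rbar_le d 2 -> Dpsi_set d.
Proof.
  intros (A & w & [[_ ->]|(_ & e & Ee & E)]) H1 H2; [contradiction|].
  destruct d as [l| |]; try contradiction. simpl in H2.
  destruct (Rle_lt_or_eq_dec l 2 H2) as [Hl| ->]; [|apply Dpsi_set_2].
  apply (delta_lt_2_reduced w e); try assumption.
  rewrite E. apply is_LimSup_seq_LimSup.
Qed.

Theorem theorem6p3 :
  (forall d : Rbar, D0_set d <-> Dpsi_set d) /\
  (forall d : Rbar,
      (D_set d /\ Rbar_le (Finite 1) d /\ Rbar_le d (Finite 2)) <-> Dpsi_set d).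
Proof.
  split; intros d; split.
  - intros H. apply abundant_delta_range in H. now apply delta_range_reduced.
  - apply reduced_delta_abundant.
  - intros (H & H1 & H2). now apply delta_range_reduced.
  - intros H. now apply abundant_delta_range, reduced_delta_abundant.
Qed.
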